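(* Let $(X,\mathcal A)$ be a $t$-$(v,k,\lambda)$ design with non-repeated blocks, and let $N\ge1$. Put $$\lambda_1=\frac{\lambda\binom{v-1}{t-1}}{\binom{k-1}{t-1}},\qquad \lambda_s^t=\frac{\lambda\binom{v-t}{k-s}}{\binom{v-t}{k-t}}\quad(1\le s\le t-1).$$ For all choices of integers $a_s\in\{0,1,\dots,\lambda_s^t\}$, $s\in\{1,\dots,t-1\}$, such that $\sum_{s=1}^{t-1}a_s\binom{t}{s}>\lambda_1$, there exists a $(v,t,N)$ hotplug coded caching scheme with memory-rate point $$\left(\frac MN,R\right)=\left(\frac{\lambda_1}{\sum_{s=1}^{t-1}a_s\binom ts},\ \frac{\sum_{s=1}^{t-1}a_s\binom{t}{s+1}}{\sum_{s=1}^{t-1}a_s\binom ts}\right).$$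
   Context: Design. For positive integers $v,k,\lambda,t$ with $v>k\ge t$, a $t$-$(v,k,\lambda)$ design is a pair $(X,\mathcal A)$ with $|X|=v$ (points) and $\mathcal A$ a collection of $k$-subsets of $X$ (blocks) such that every set of $t$ distinct points is contained in exactly $\lambda$ blocks. Hotplug coded caching. In a $(K,K',N)$ hotplug coded caching system ($K'\le K$) a server stores $N$ files $W_1,\dots,W_N$, each of size $L$ bits (for a suitable $L$, so that files can be split and MDS-coded as needed), and is connected to $K$ users by an error-free shared link; each user has a cache of size $M$ files ($ML$ bits). In the placement phase the server fills the caches with functions of the files, knowing $K'$ but neither the identity of the $K'$ users who will be active nor the demands. In the delivery phase an arbitrary set $I\subseteq\{1,\dots,K\}$, $|I|=K'$, of active users reveals arbitrary demands $(d_i)_{i\in I}\in\{1,\dots,N\}^{I}$; the server broadcasts a message of size $RL$ bits, depending on the files, $I$ and the demands, such that each active user $i$ recovers $W_{d_i}$ from the message and its own cache. $R$ is the rate. The scheme must work for all files, all $I$ and all demands. *)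

(* Defs.v *)
From mathcomp Require Import all_boot all_order all_algebra.
Set Implicit Arguments.
Unset Strict Implicit.
Unset Printing Implicit Defensive.
Import Order.TTheory GRing.Theory Num.Theory.
Local Open Scope ring_scope.

(* The blocks form a sequence, so a block may a priori be repeated and every
   occurrence is counted; a design without repeated blocks is one whose block
   sequence is [uniq]. *)
Definition is_design (t v k lambda : nat) (X : finType) (A : seq {set X})
    : Prop :=
  [/\ (0 < t <= k)%N, (k < v)%N, (0 < lambda)%N & #|X| = v] /\
  [/\ forall B : {set X}, B \in A -> #|B| = k
    & forall T : {set X}, #|T| = t ->
        count (fun B : {set X} => T \subset B) A = lambda].

(* In a design, the number of blocks through a given point. *)
Definition lambda_1 (t v k lambda : nat) : rat :=
  lambda%:R * 'C(v - 1, t - 1)%:R / 'C(k - 1, t - 1)%:R.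

(* In a design, the number of blocks meeting a given [t]-set of points in exactly
   a given [s]-subset of it. *)
Definition lambda_st (t v k lambda s : nat) : rat :=
  lambda%:R * 'C(v - t, k - s)%:R / 'C(v - t, k - t)%:R.

Definition library (N L : nat) : finType := {ffun 'I_N -> L.-tuple bool}.

(* Only the active users have a demand. *)
Definition demands (K N : nat) (I : {set 'I_K}) : finType :=
  {ffun {i : 'I_K | i \in I} -> 'I_N}.

(* [L], [cbits] and [mbits] are the lengths in bits of a file, of a cache and of
   the broadcast message. The cache contents depend on the library only; the
   active set and the demands are public during delivery, so they are available
   to the decoders. *)
Record hotplug_scheme (K K' N L cbits mbits : nat) : Type := HotplugScheme {
  hs_active_le : (K' <= K)%N;
  hs_cache : 'I_K -> library N L -> cbits.-tuple bool;
  hs_message : forall I : {set 'I_K},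
    demands N I -> library N L -> mbits.-tuple bool;
  hs_decode : forall I : {set 'I_K}, demands N I -> {i : 'I_K | i \in I} ->
    mbits.-tuple bool -> cbits.-tuple bool -> L.-tuple bool;
  hs_correct : forall I : {set 'I_K}, #|I| = K' ->
    forall (d : demands N I) (W : library N L) (i : {i : 'I_K | i \in I}),
      hs_decode d i (hs_message d W) (hs_cache (val i) W) = W (d i) }.

(* The pair [(x, R)] is [(M / N, R)]: caches have [M * L] bits and messages
   [R * L] bits, for some file length [L]. *)
Definition has_hotplug_scheme (K K' N : nat) (point : rat * rat) : Prop :=
  exists M R : rat, point = (M / N%:R, R) /\
  exists L cbits mbits : nat,
    [/\ (0 < L)%N, cbits%:R = M * L%:R, mbits%:R = R * L%:R
      & inhabited (hotplug_scheme K K' N L cbits mbits)].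

(* Main.v *)
(* Let r = lambda_1 be the number of blocks through a point, S the sum of the
   a_s C(t,s), and read a file as a polynomial of degree < S over GF(2^m), with one
   evaluation point per block (an MDS code). User x caches the values of all files
   at the r blocks through x. For active users I and Y a subset of I, pick a_s
   blocks B(Y,1), B(Y,2), ... meeting I exactly in Y, s = |Y|. For each (s+1)-subset
   Z of I and each j <= a_s the server sends the sum over x in Z of the value of
   x's demanded file at B(Z - x, j). A user i of Z has all other terms in its cache,
   since i lies in Z - x, so it learns its own file at B(Y, j) for every Y not
   containing i; for Y containing i that value is in its cache. This gives S values
   at distinct points, which determine the polynomial. *)
Require Import Defs.
From mathcomp Require Import all_boot all_order all_algebra finfield.
Import Order.TTheory GRing.Theory Num.Theory.
Local Open Scope ring_scope.

(** * Bit strings for finite alphabets *)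

Definition encode (T : finType) (n : nat) (x : T) : n.-tuple bool :=
  nth [tuple of nseq n false] (enum {: n.-tuple bool}) (enum_rank x).

Lemma encode_inj (T : finType) (n : nat) :
  (#|T| <= 2 ^ n)%N -> injective (@encode T n).
Proof.
move=> leTn x y /eqP; rewrite /encode.
have szE : size (enum {: n.-tuple bool}) = (2 ^ n)%N.
  by rewrite -cardE card_tuple card_bool.
rewrite nth_uniq ?enum_uniq ?szE ?(leq_trans (ltn_ord _)) //.
by move=> /eqP /ord_inj /enum_rank_inj.
Qed.

(* The decoder returns the demanded file of any library consistent with what it
   sees, so only the injectivity hypothesis has to be checked. *)
Lemma hotplug_scheme_of_injective (K K' N L cbits mbits : nat)
    (C : 'I_K -> finType) (cache : forall i, library N L -> C i)
    (Msg : {set 'I_K} -> finType)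
    (msg : forall I : {set 'I_K}, demands N I -> library N L -> Msg I) :
  (K' <= K)%N ->
  (forall i, #|C i| <= 2 ^ cbits)%N ->
  (forall I : {set 'I_K}, #|I| = K' -> #|Msg I| <= 2 ^ mbits)%N ->
  (forall I : {set 'I_K}, #|I| = K' -> forall (d : demands N I) i (W W' : library N L),
     msg I d W = msg I d W' -> cache (val i) W = cache (val i) W' ->
     W (d i) = W' (d i)) ->
  inhabited (hotplug_scheme K K' N L cbits mbits).
Proof.
move=> leK leC leM inj.
pose dec (I : {set 'I_K}) (d : demands N I) (i : {i : 'I_K | i \in I})
    (m : mbits.-tuple bool) (c : cbits.-tuple bool) : L.-tuple bool :=
  if [pick W | (encode _ mbits (msg I d W) == m)
               && (encode _ cbits (cache (val i) W) == c)] is Some W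
  then W (d i) else [tuple of nseq L false].
split; apply: (@HotplugScheme _ _ _ _ _ _ leK
  (fun i W => encode _ _ (cache i W)) (fun I d W => encode _ _ (msg I d W)) dec).
move=> I cI d W i; rewrite /dec; case: pickP => [W' /andP[/eqP eqm /eqP eqc]|].
  apply: (inj I cI).
    exact: (encode_inj _ _ (leM I cI)) eqm.
  exact: (encode_inj _ _ (leC _)) eqc.
by move=> /(_ W); rewrite !eqxx.
Qed.

(** * Interpolation and indexing by subsets *)

Lemma sum_subset_card (T : finType) (I : {set T}) (g : nat -> nat) :
  (\sum_(Y : {set T} | Y \subset I) g #|Y| = \sum_(s < #|I|.+1) g s * 'C(#|I|, s))%N.
Proof.
rewrite (partition_big (fun Y : {set T} => inord #|Y| : 'I_#|I|.+1) predT) //=.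
apply: eq_bigr => s _.
transitivity (\sum_(Y in [set Y : {set T} | Y \subset I & #|Y| == s]) g s)%N.
  2: by rewrite sum_nat_const cards_draws mulnC.
apply: eq_big => [Y|Y /andP[sYI /eqP <-]]; last first.
  by rewrite inordK // ltnS subset_leq_card.
rewrite !inE; case: (boolP (Y \subset I)) => //= sYI.
by rewrite -val_eqE /= inordK // ltnS subset_leq_card.
Qed.

Lemma poly_eq_on_injective (F : fieldType) (T : finType) (h : T -> F)
    (p q : {poly F}) :
  injective h -> (size p <= #|T|)%N -> (size q <= #|T|)%N ->
  (forall u, p.[h u] = q.[h u]) -> p = q.
Proof.
move=> h_inj sp sq eqpq; apply/eqP; rewrite -subr_eq0; apply/negPn/negP => nz.
have := max_poly_roots (rs := map h (enum T)) nz.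
rewrite map_inj_uniq // enum_uniq size_map -cardE ltnNge.
rewrite (leq_trans (size_polyD _ _)) ?geq_max ?size_polyN ?sp ?sq //.
suff -> : all (root (p - q)) (map h (enum T)) by move=> /(_ isT isT).
by apply/allP => _ /mapP[u _ ->]; rewrite rootE !hornerE eqpq subrr.
Qed.

(** The bound is 0 outside [I], so [Y \subset I] is carried by the type. One choice of [g] indexes
    the evaluation points that a user recovers, a shifted one the transmissions. *)
Definition slots (T : finType) (I : {set T}) (g : nat -> nat) : finType :=
  {Y : {set T} & 'I_(if Y \subset I then g #|Y| else 0)}.

Lemma slot_subset {T : finType} {I : {set T}} {g : nat -> nat} (u : slots T I g) :
  tag u \subset I.
Proof. by case: u => Y /=; case: ifP => // _ []. Qed.

Lemma slot_lt {T : finType} {I : {set T}} {g : nat -> nat} (u : slots T I g) :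
  (tagged u < g #|tag u|)%N.
Proof. by case: u => Y /=; case: ifP => // _ []. Qed.

Lemma slot_inj {T : finType} {I : {set T}} {g : nat -> nat} {u u' : slots T I g} :
  tag u = tag u' -> tagged u = tagged u' :> nat -> u = u'.
Proof.
case: u u' => [Y j] [Y' j'] /= eqY; case: Y' / eqY j' => j'.
by move/ord_inj ->.
Qed.

Definition slot {T : finType} {I Y : {set T}} {g : nat -> nat} {j : nat}
    (sYI : Y \subset I) (ltj : (j < g #|Y|)%N) : slots T I g :=
  Tagged (fun Y : {set T} => 'I_(if Y \subset I then g #|Y| else 0))
    (Ordinal (etrans (congr1 (fun b : bool => j < if b then g #|Y| else 0)%N sYI) ltj)).

Lemma card_slots (T : finType) (I : {set T}) (g : nat -> nat) :
  (#|slots T I g| = \sum_(s < #|I|.+1) g s * 'C(#|I|, s))%N.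
Proof.
rewrite card_tagged sumnE big_map big_enum /= -sum_subset_card [RHS]big_mkcond.
by apply: eq_bigr => Y _; rewrite card_ord.
Qed.

Lemma card_le_injective (T U : finType) :
  (#|T| <= #|U|)%N -> exists f : T -> U, injective f.
Proof.
move=> leTU; exists (fun x => enum_val (widen_ord leTU (enum_rank x))) => x y.
by move=> /enum_val_inj/(congr1 val)/= /ord_inj/enum_rank_inj.
Qed.

(** The coding half, free of design theory: it needs few blocks per user and enough blocks for each
    trace on [I]. The factor [m] is the bit length of a field element. *)
Lemma hotplug_scheme_of_incidence (K t N r : nat) (Bl : finType)
    (inc : 'I_K -> pred Bl) (a : nat -> nat) :
  (t <= K)%N -> (forall x, #|inc x| <= r)%N ->
  (forall I Y : {set 'I_K}, #|I| = t -> Y \subset I ->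
     a #|Y| <= #|[pred B | [set x in I | inc x B] == Y]|)%N ->
  exists2 m : nat, (0 < m)%N & inhabited (hotplug_scheme K t N
    ((\sum_(s < t.+1) a s * 'C(t, s)) * m) (N * r * m)
    ((\sum_(s < t) a s * 'C(t, s.+1)) * m)).
Proof.
move=> letK cardr leaY; set S := (\sum_(s < t.+1) _)%N.
(* The transmission sum for [(Z, j)] uses block number [j] of [Z :\ x], of size
   [#|Z| - 1], hence the shift; nothing is sent for empty [Z]. *)
pose b s := if s is s'.+1 then a s' else 0%N.
have sumb : (\sum_(s < t) a s * 'C(t, s.+1) = \sum_(s < t.+1) b s * 'C(t, s))%N.
  by rewrite big_ord_recl.
(* This makes 2^m exceed the number of blocks, so each block gets its own evaluation point. *)
exists #|Bl|.+1 => //; set m := #|Bl|.+1.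
have [F _ cardF] := pPrimePowerField (isT : prime 2) (isT : (0 < m)%N).
have [al al_inj] : exists al : Bl -> F, injective al.
  apply: card_le_injective; rewrite cardF.
  by rewrite (leq_trans (leqnSn _)) // ltnW // ltn_expl.
have [phi phi_inj] : exists phi : (S * m).-tuple bool -> 'rV[F]_S, injective phi.
  by apply: card_le_injective; rewrite card_tuple card_bool card_mx cardF mul1n -expnM mulnC.
pose P w : {poly F} := rVpoly (phi w).
have P_inj : injective P by move=> w w' /(can_inj (@rVpolyK _ _))/phi_inj.
pose pts (I Y : {set 'I_K}) := [seq al B | B <- enum [pred B | [set x in I | inc x B] == Y]].
pose cache x (W : library N (S * m)) : {ffun 'I_N * {B | inc x B} -> F} :=
  [ffun nB => (P (W nB.1)).[al (val nB.2)]].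
(* For [#|I| = t] the default 0 is never read: the index is below [b #|Z|], that is [a (#|Z| - 1)],
   and [leaY] provides that many points. *)
pose msg (I : {set 'I_K}) (d : demands N I) (W : library N (S * m)) :
    {ffun slots _ I b -> F} :=
  [ffun u : slots _ I b => \sum_(x : {x | x \in I} | val x \in tag u)
     (P (W (d x))).[nth 0 (pts I (tag u :\ val x)) (tagged u)]].
rewrite sumb.
apply: (hotplug_scheme_of_injective _ _ _ _ _ _ (fun x => _) cache (fun I => _) msg) => //.
- move=> x; rewrite card_ffun card_prod card_ord card_sig cardF -expnM mulnC.
  by rewrite leq_exp2l // leq_mul2r leq_mul2l cardr !orbT.
- by move=> I cI; rewrite card_ffun card_slots cardF cI -expnM mulnC.
move=> I cI d i W W' eqmsg eqcache.
pose pt (u : slots _ I a) := nth 0 (pts I (tag u)) (tagged u).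
have sizepts (u : slots _ I a) : (tagged u < size (pts I (tag u)))%N.
  rewrite size_map -cardE (leq_trans (slot_lt u)) //.
  exact: leaY (slot_subset u).
have ptE u : exists2 B, pt u = al B & [set x in I | inc x B] = tag u.
  have : pt u \in pts I (tag u) by rewrite mem_nth.
  by move=> /mapP[B BY ->]; exists B => //; move: BY; rewrite mem_enum => /eqP.
(* Different traces on [I] force different blocks; for equal traces, the position in a
   duplicate-free list decides. *)
have ptI : injective pt.
  move=> u u' eqpt; have [B eB tB] := ptE u; have [B' eB' tB'] := ptE u'.
  have eBB : B = B' by apply: al_inj; rewrite -eB -eB' eqpt.
  have etag : tag u = tag u' by rewrite -tB -tB' eBB.
  apply: (slot_inj etag); apply/eqP; move/eqP: eqpt; rewrite /pt.
  have -> : pts I (tag u') = pts I (tag u) by rewrite etag.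
  by rewrite nth_uniq ?map_inj_uniq ?enum_uniq // {1}etag.
(* A block whose trace contains [i] passes through [i], so user [i] caches its values. *)
have cached n (u : slots _ I a) : val i \in tag u -> (P (W n)).[pt u] = (P (W' n)).[pt u].
  have [B -> tB] := ptE u; rewrite -tB inE => /andP[_ iB].
  by move/ffunP: eqcache => /(_ (n, exist _ B iB)); rewrite !ffunE.
have sizeP w : (size (P w) <= #|slots _ I a|)%N.
  by rewrite card_slots cI -/S size_poly.
apply: P_inj; apply: (poly_eq_on_injective _ _ pt _ _ ptI (sizeP _) (sizeP _)) => u.
have [/cached //|iu] := boolP (val i \in tag u).
(* The missing value comes from the transmission for [val i |: tag u] with the same index, whose
   term for [i] is evaluated at [pt u]. *)
have sZI : val i |: tag u \subset I.
  by rewrite subUset sub1set (valP i) slot_subset.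
have ltZ : (tagged u < b #|val i |: tag u|)%N by rewrite cardsU1 iu slot_lt.
move/ffunP: eqmsg => /(_ (slot sZI ltZ)); rewrite !ffunE /=.
rewrite (bigD1 i) ?setU11 //= [in RHS](bigD1 i) ?setU11 //= setU1K //.
set s1 := \sum_(_ | _) _; set s2 := \sum_(_ | _) _.
suff -> : s1 = s2 by move/addIr.
(* The term of another user [x] uses the trace Z - x, which still contains [i], so it is cached. *)
apply: eq_bigr => x /andP[xZ xi].
have sYI : (val i |: tag u) :\ val x \subset I by rewrite (subset_trans (subD1set _ _)).
have ltY : (tagged u < a #|(val i |: tag u) :\ val x|)%N.
  by move: ltZ; rewrite (cardsD1 (val x)) xZ.
apply: (cached _ (slot sYI ltY)); rewrite /= in_setD1 setU11 andbT.
by rewrite eq_sym; apply: contra_neq xi => /val_inj.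
Qed.

(** * Block counts in a design *)

Section DesignCounting.
Local Open Scope nat_scope.

Lemma disjoint_setU1 (X : finType) (x : X) (A B : {set X}) :
  [disjoint x |: A & B] = (x \notin B) && [disjoint A & B].
Proof. by rewrite -disjointU1; apply: eq_disjoint => y; rewrite !inE. Qed.

(** Both sides count nested pairs of an m-set in a k-set among n points. *)
Lemma mul_bin_bin (n k m : nat) : m <= k <= n ->
  'C(n, k) * 'C(k, m) = 'C(n, m) * 'C(n - m, k - m).
Proof.
move=> /andP[lemk lekn].
have f0 : 0 < m`! * (k - m)`! * (n - k)`! by rewrite !muln_gt0 !fact_gt0.
apply/eqP; rewrite -(eqn_pmul2r f0); apply/eqP.
transitivity n`!.
  by rewrite -(bin_fact lekn) -(bin_fact lemk) -!mulnA.
have lemn := leq_trans lemk lekn; have lekmnm := leq_sub2r m lekn.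
rewrite -(bin_fact lemn) -(bin_fact lekmnm) subnBA // subnK //.
by rewrite -!mulnA; congr (_ * _); rewrite mulnCA.
Qed.

(** Double counting of the pairs (B, x) with [Y \subset B] and [x] in [B :\: Y]. *)
Lemma count_superset_step (X : finType) (k : nat) (A : seq {set X}) (Y : {set X}) :
  (forall B, B \in A -> #|B| = k) ->
  count (fun B : {set X} => Y \subset B) A * (k - #|Y|)
    = \sum_(x | x \notin Y) count (fun B : {set X} => x |: Y \subset B) A.
Proof.
move=> cardA; rewrite -sum1_count big_distrl /=.
transitivity (\sum_(B <- A | Y \subset B) \sum_(x in B :\: Y) 1).
  rewrite big_seq_cond [RHS]big_seq_cond; apply: eq_bigr => B /andP[BA sYB].
  by rewrite sum1_card cardsD (setIidPr sYB) (cardA B) ?mul1n.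
rewrite (exchange_big_dep (fun x => x \notin Y)) /=; last first.
  by move=> B x _; rewrite inE => /andP[].
apply: eq_bigr => x xY; rewrite -sum1_count; apply: eq_bigl => B.
by rewrite subUset sub1set inE xY andbC.
Qed.

Section Design.
Variables (t v k lambda : nat) (X : finType) (A : seq {set X}).
Hypothesis hA : is_design t v k lambda A.

Let cont (Y : {set X}) := count (fun B : {set X} => Y \subset B) A.

Lemma design_superset_step (i c : nat) (Y : {set X}) :
  #|Y| = i -> (forall x, x \notin Y -> cont (x |: Y) = c) ->
  cont Y * (k - i) = (v - i) * c.
Proof.
case: hA => [[_ _ _ <-] [cardA _]] <- eqc.
rewrite /cont count_superset_step // (eq_bigr (fun=> c)) //.
by rewrite sum_nat_const -(cardC Y) addKn.
Qed.

(** Descending induction on [#|Y|], starting from the design axiom at size [t]; the product form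
    avoids division in [nat]. *)
Lemma design_count_superset (Y : {set X}) :
  #|Y| <= t -> cont Y * 'C(v - t, k - t) = lambda * 'C(v - #|Y|, k - #|Y|).
Proof.
case: hA => [[/andP[_ letk] ltkv _ _] [_ count_t]].
move: {2}(t - #|Y|) (erefl (t - #|Y|)) => n; elim: n Y => [|n IHn] Y.
  move/eqP; rewrite subn_eq0 => leY geY.
  by have cY : #|Y| = t; [apply/eqP; rewrite eqn_leq leY geY|rewrite /cont count_t ?cY].
move=> tY _; have ltYt : #|Y| < t by rewrite -subn_gt0 tY.
have C0 : 0 < 'C(v - t, k - t) by rewrite bin_gt0 leq_sub2r // ltnW.
(* The double count needs a value independent of [x]; the induction hypothesis makes this quotient
   exact. *)
have step x : x \notin Y -> cont (x |: Y) = lambda * 'C(v - #|Y|.+1, k - #|Y|.+1) %/ 'C(v - t, k - t).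
  move=> xY; have cxY : #|x |: Y| = #|Y|.+1 by rewrite cardsU1 xY.
  by rewrite -cxY -IHn ?mulnK // cxY // subnS tY.
have k0 : 0 < k - #|Y| by rewrite subn_gt0 (leq_trans ltYt).
apply/eqP; rewrite -(eqn_pmul2r k0) mulnAC (design_superset_step _ _ _ erefl step).
(* A witness outside [Y] turns the quotient back into a count. *)
have [x xY] : exists x, x \notin Y.
  apply/existsP; rewrite -negb_forall; apply: contraTN ltYt => /forallP YT.
  have -> : Y = setT by apply/setP => x; rewrite YT inE.
  case: hA => [[_ _ _ cX] _].
  by rewrite cardsT cX -leqNgt ltnW // (leq_ltn_trans letk).
rewrite -mulnA -(step x xY) IHn; last 2 first.
- by rewrite cardsU1 xY subnS tY.
- by rewrite cardsU1 xY.
rewrite cardsU1 xY mulnCA -mulnA; apply/eqP; congr (_ * _).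
by rewrite !add1n !subnS mul_bin_diag prednK // mulnC.
Qed.

(** Induction on [#|J|]: blocks avoiding [J :\ x] either avoid or contain [x], and Pascal's rule
    matches this split. Sizes s and t - s give [lambda_st]. *)
Lemma design_count_superset_disjoint (Y J : {set X}) :
  [disjoint Y & J] -> #|Y| + #|J| <= t ->
  count (fun B : {set X} => (Y \subset B) && [disjoint J & B]) A * 'C(v - t, k - t)
    = lambda * 'C(v - (#|Y| + #|J|), k - #|Y|).
Proof.
have [[/andP[_ letk] ltkv _ _] _] := hA.
move: {2}#|J| (erefl #|J|) => n; elim: n Y J => [|n IHn] Y J.
  move/eqP; rewrite cards_eq0 => /eqP -> _; rewrite cards0 addn0.
  move/design_count_superset => <-; congr (_ * _).
  by apply: eq_count => B; rewrite -setI_eq0 set0I eqxx andbT.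
move=> cJ; have [x xJ] : exists x, x \in J by apply/card_gt0P; rewrite cJ.
have cJ' : #|J :\ x| = n by move: cJ; rewrite (cardsD1 x) xJ => -[].
move=> dYJ; rewrite cJ addnS => leYJ.
have xY : x \notin Y by rewrite (disjointFl dYJ).
have dYJ' : [disjoint Y & J :\ x].
  by rewrite (disjointWr _ dYJ) // subD1set.
have dxYJ' : [disjoint x |: Y & J :\ x].
  by rewrite disjoint_setU1 dYJ' setD11.
have := IHn Y _ cJ' dYJ'; rewrite cJ' => /(_ (ltnW leYJ)).
have := IHn (x |: Y) _ cJ' dxYJ'; rewrite cJ' cardsU1 xY add1n addSn => /(_ leYJ).
set c1 := count _ A; set c2 := count _ A; set c3 := count _ A => e1 e2.
have ec : c2 = c3 + c1.
  rewrite /c1 /c2 /c3 -!sum1_count (bigID (fun B : {set X} => x \notin B)) /=.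
  congr (_ + _); apply: eq_bigl => B.
    rewrite -andbA; congr (_ && _).
    by rewrite -[in RHS](setD1K xJ) disjoint_setU1 andbC.
  by rewrite negbK subUset sub1set andbC andbA.
apply/eqP; rewrite -(eqn_add2r (c1 * 'C(v - t, k - t))) -mulnDl -ec e2 e1 -mulnDr.
apply/eqP; congr (_ * _).
have v0 : 0 < v - (#|Y| + n) by rewrite subn_gt0 (leq_trans leYJ) // (leq_trans letk) // ltnW.
have k0 : 0 < k - #|Y|.
  by rewrite subn_gt0 (leq_trans _ letk) // (leq_trans _ leYJ) // ltnS leq_addr.
by rewrite !subnS -(prednK v0) -(prednK k0) binS.
Qed.

(** The singleton case, with the denominator traded by [mul_bin_bin] for that of [lambda_1]. *)
Lemma design_count_point (x : X) :
  count (fun B : {set X} => x \in B) A * 'C(k - 1, t - 1) = lambda * 'C(v - 1, t - 1).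
Proof.
have [[/andP[t0 letk] ltkv _ _] _] := hA.
have C0 : 0 < 'C(v - t, k - t) by rewrite bin_gt0 leq_sub2r // ltnW.
have -> : count (fun B : {set X} => x \in B) A = cont [set x].
  by apply: eq_count => B; rewrite sub1set.
apply/eqP; rewrite -(eqn_pmul2r C0) mulnAC design_count_superset ?cards1 // -!mulnA.
rewrite mul_bin_bin ?leq_sub2r // ?(ltnW ltkv) //.
by rewrite !subnBA // !subnK // ?(leq_trans t0) // (leq_trans letk) // ltnW.
Qed.

End Design.
End DesignCounting.

(** * From designs to schemes *)

Lemma card_tnth (T : eqType) (A : seq T) (p : pred T) :
  #|[pred i : 'I_(size A) | p (tnth (in_tuple A) i)]| = count p A.
Proof. by rewrite -sum1_card -sum1_count [RHS]big_tnth. Qed.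

Lemma sum_truncate (t : nat) (a c : nat -> nat) : (0 < t)%N ->
  (\sum_(s < t.+1) (if 0 < s < t then a s else 0) * c s = \sum_(1 <= s < t) a s * c s)%N.
Proof.
move=> t0; rewrite -(big_mkord xpredT (fun s => (if 0 < s < t then a s else 0) * c s)%N).
rewrite [LHS]big_ltn // big_nat_recr //= ltnn andbF !mul0n add0n addn0.
by apply: eq_big_nat => s ->.
Qed.

Theorem theorem6 (t v k lambda : nat) (X : finType) (A : seq {set X})
    (hdesign : is_design t v k lambda A) (hnonrep : uniq A)
    (N : nat) (hN : (1 <= N)%N)
    (a : nat -> nat)
    (ha : forall s : nat, (1 <= s <= t - 1)%N ->
            (a s)%:R <= lambda_st t v k lambda s)
    (hsum : lambda_1 t v k lambda <
            \sum_(1 <= s < t) (a s)%:R * 'C(t, s)%:R) :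
  has_hotplug_scheme v t N
    (lambda_1 t v k lambda / (\sum_(1 <= s < t) (a s)%:R * 'C(t, s)%:R),
     (\sum_(1 <= s < t) (a s)%:R * 'C(t, s.+1)%:R) /
       (\sum_(1 <= s < t) (a s)%:R * 'C(t, s)%:R)).
Proof.
have [[/andP[t0 letk] ltkv l0 cX] _] := hdesign; subst v.
pose v := #|X|.
have C0 : (0 < 'C(v - t, k - t))%N by rewrite bin_gt0 leq_sub2r // ltnW.
have C1 : (0 < 'C(k - 1, t - 1))%N by rewrite bin_gt0 leq_sub2r.
pose inc (x : 'I_v) := [pred B : 'I_(size A) | enum_val x \in tnth (in_tuple A) B].
(* Any user serves as reference, since [incE] gives all points the same count. *)
pose x0 : 'I_v := Ordinal (leq_ltn_trans (leq0n k) ltkv).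
pose r := #|inc x0|.
have incE x : (#|inc x| * 'C(k - 1, t - 1) = lambda * 'C(v - 1, t - 1))%N.
  rewrite -(design_count_point _ _ _ _ _ _ hdesign (enum_val x)); congr (_ * _)%N.
  exact: (card_tnth _ A (fun B : {set X} => enum_val x \in B)).
have l1E : lambda_1 t v k lambda = r%:R.
  by rewrite /lambda_1 -natrM -(incE x0) natrM mulfK // pnatr_eq0 -lt0n.
(* [ha] bounds [a] only for 0 < s < t; multiplicity 0 elsewhere makes the requirement trivial and
   removes the extra terms of the sums. *)
pose a' s := if (0 < s < t)%N then a s else 0%N.
have [] := hotplug_scheme_of_incidence v t N r _ inc a'.
- exact: leq_trans letk (ltnW ltkv).
- by move=> x; rewrite -(leq_pmul2r C1) !incE.
- move=> I Y cI sYI; rewrite /a'; case: ifP => // /andP[Y0 Yt].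
  set e : 'I_v -> X := enum_val.
  have e_inj : injective e := enum_val_inj.
  (* Having trace [Y] means containing [Y] and avoiding [I :\: Y], two sets whose sizes add up to
     [t]. *)
  have -> : #|[pred B | [set x in I | inc x B] == Y]|
      = count (fun B : {set X} => (e @: Y \subset B) && [disjoint e @: (I :\: Y) & B]) A.
    rewrite -card_tnth; apply: eq_card => i; rewrite !inE.
    set B := tnth _ _; apply/eqP/andP => [eY|[sYB dB]].
      split.
        by apply/subsetP => _ /imsetP[x + ->]; rewrite -eY !inE => /andP[].
      rewrite disjoint_subset; apply/subsetP => _ /imsetP[x + ->].
      by rewrite -eY !inE => /andP[+ xI]; rewrite xI.
    apply/setP => x; rewrite !inE; apply/andP/idP => [[xI xB]|xY].
      apply: contraLR xB => xY; rewrite (disjointFr dB) //.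
      by apply: imset_f; rewrite inE xY.
    by split; [apply: (subsetP sYI)|apply: (subsetP sYB); apply: imset_f].
  have dYJ : [disjoint e @: Y & e @: (I :\: Y)].
    rewrite disjoint_subset; apply/subsetP => _ /imsetP[x xY ->].
    by rewrite inE mem_imset // inE xY.
  have cYJ : (#|e @: Y| + #|e @: (I :\: Y)| = t)%N.
    by rewrite !card_imset // cardsD (setIidPr sYI) subnKC ?cI // -cI subset_leq_card.
  rewrite -(leq_pmul2r C0) (design_count_superset_disjoint _ _ _ _ _ _ hdesign) ?cYJ //.
  rewrite card_imset // -(ler_nat rat) !natrM -ler_pdivlMr ?ltr0n //.
  by apply: ha; rewrite Y0 /= -ltnS subn1 prednK.
rewrite sum_truncate //.
have -> : (\sum_(s < t) a' s * 'C(t, s.+1) = \sum_(1 <= s < t) a s * 'C(t, s.+1))%N.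
  rewrite -(sum_truncate t a (fun s => 'C(t, s.+1)) t0) [RHS]big_ord_recr /=.
  by rewrite ltnn andbF addn0.
have sumR c : \sum_(1 <= s < t) (a s)%:R * (c s)%:R = (\sum_(1 <= s < t) a s * c s)%:R :> rat.
  by rewrite natr_sum; apply: eq_bigr => s _; rewrite natrM.
rewrite sumR (sumR (fun s => 'C(t, s.+1))) l1E in hsum *.
set S := (\sum_(1 <= s < t) a s * 'C(t, s))%N in hsum *.
set R := (\sum_(1 <= s < t) a s * 'C(t, s.+1))%N.
have S0 : (0 < S)%N by rewrite -(ltr0n rat) (le_lt_trans _ hsum).
have SR0 : S%:R != 0 :> rat by rewrite pnatr_eq0 -lt0n.
have NR0 : N%:R != 0 :> rat by rewrite pnatr_eq0 -lt0n.
move=> m m0 scheme.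
(* A cache of N r m bits against files of S m bits is N r / S files. *)
exists (N%:R * (r%:R / S%:R)), (R%:R / S%:R); split; first by rewrite [N%:R * _]mulrC mulfK.
exists (S * m)%N, (N * r * m)%N, (R * m)%N; split=> //.
- by rewrite muln_gt0 S0.
- by rewrite !natrM -!mulrA mulKf.
- by rewrite !natrM -!mulrA mulKf.
Qed.
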